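(* Let $M$ be a sclocc median algebra and let $\mu$ be a balanced Borel probability measure on $M$. Then $\mu$ is cubical; that is, there exist a countable set $I$ and an injective continuous median morphism $f:\{0,1\}^I\to M$ such that $\mu=f_*(\lambda)$, where $\lambda$ is the uniform measure on $\{0,1\}^I$.
   Context: A median algebra is a set $M$ with a ternary operation $m:M^3\to M$ (the median operator) such that for all $x,y,z,u,v\in M$: (1) $m(x,y,z)=m(x,z,y)=m(y,x,z)$; (2) $m(x,x,y)=x$; (3) $m(m(x,y,z),u,v)=m(x,m(y,u,v),m(z,u,v))$. A median morphism is a map $\varphi$ between median algebras with $\varphi(m(x,y,z))=m(\varphi(x),\varphi(y),\varphi(z))$. For $x,y\in M$ the interval is $[x,y]=\{u\in M: m(x,y,u)=u\}$; a subset $C\subset M$ is convex if $[x,y]\subset C$ for all $x,y\in C$. A topological median algebra is a median algebra with a Hausdorff topology for which $m$ is continuous. It is locally open-convex if every point has a basis of open and convex neighborhoods. It is sclocc if it is second countable, locally open-convex and compact. For a sclocc median algebra $M$, $\operatorname{Prob}(M)$ is the set of Borel probability measures on $M$, and the self-median operator is $\Phi:\operatorname{Prob}(M)\to\operatorname{Prob}(M)$, $\Phi(\mu)=m_*(\mu^3)$, where $\mu^3=\mu\otimes\mu\otimes\mu$. A measure $\mu$ is balanced if $\Phi(\mu)=\mu$. The set $\{0,1\}$ carries the standard (majority) median operation; $\{0,1\}^I$ carries the coordinate-wise median and the product topology. Countable sets may be finite or empty. The uniform measure on $\{0,1\}^I$ is the product measure $\lambda=(\tfrac12\delta_0+\tfrac12\delta_1)^I$.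 *)

(* Defs.v *)
From HB Require Import structures.
From mathcomp Require Import all_boot all_order all_algebra finmap.
From mathcomp Require Import all_classical all_reals all_analysis.
Set Implicit Arguments.
Unset Strict Implicit.
Unset Printing Implicit Defensive.
Import Order.TTheory GRing.Theory Num.Theory.
Import numFieldNormedType.Exports.
Local Open Scope classical_set_scope.
Local Open Scope ring_scope.

Record median_algebra (M : Type) (m : M -> M -> M -> M) : Prop := {
  medianCr : forall x y z, m x y z = m x z y ;
  medianCl : forall x y z, m x y z = m y x z ;
  medianxx : forall x y, m x x y = x ;
  medianD : forall x y z u v, m (m x y z) u v = m x (m y u v) (m z u v) }.

Definition median_morphism (M N : Type) (m : M -> M -> M -> M)
    (n : N -> N -> N -> N) (f : M -> N) : Prop :=
  forall x y z, f (m x y z) = n (f x) (f y) (f z).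

Definition median_interval (M : Type) (m : M -> M -> M -> M) (x y : M) : set M :=
  [set u | m x y u = u].

Definition median_convex (M : Type) (m : M -> M -> M -> M) (C : set M) : Prop :=
  forall x y, C x -> C y -> median_interval m x y `<=` C.

Record topological_median_algebra (M : topologicalType) (m : M -> M -> M -> M)
    : Prop := {
  tma_median : median_algebra m ;
  tma_hausdorff : hausdorff_space M ;
  tma_continuous : continuous (fun p : M * M * M => m p.1.1 p.1.2 p.2) }.

Definition locally_open_convex (M : topologicalType) (m : M -> M -> M -> M)
    : Prop :=
  forall (x : M) (U : set M), nbhs x U ->
    exists V : set M, [/\ open V, median_convex m V, V x & V `<=` U].

Record sclocc (M : topologicalType) (m : M -> M -> M -> M) : Prop := {
  sclocc_tma : topological_median_algebra m ;
  sclocc_second_countable : @second_countable M ;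
  sclocc_locally_open_convex : locally_open_convex m ;
  sclocc_compact : compact [set: M] }.

Definition borel (M : ptopologicalType) := g_sigma_algebraType (@open M).

HB.instance Definition _ (M : ptopologicalType) := Measurable.on (borel M).

Section self_median.
Context (R : realType) (M : ptopologicalType) (m : M -> M -> M -> M).
Local Open Scope ereal_scope.

(* Second countability makes the Borel sigma-algebra of the topological product
   coincide with the product sigma-algebra used by [\x], so that the preimages
   occurring in [self_median] below are measurable. *)
Lemma measurable_median : sclocc m ->
  measurable_fun [set: borel M * borel M * borel M]
    ((fun p => m p.1.1 p.1.2 p.2) : borel M * borel M * borel M -> borel M).
Proof.
case=> -[_ _ cm] [B cB [Bo Bb]] _ _.
apply: measurability; first exact: erefl.
move=> _ [U oU <-].
rewrite setTI.
set W := (X in measurable X).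
pose box (t : set M * set M * set M) : set (borel M * borel M * borel M) :=
  t.1.1 `*` t.1.2 `*` t.2.
pose D := [set t | (B `*` B `*` B) t /\ box t `<=` W].
have -> : W = \bigcup_(t in D) box t.
  apply/seteqP; split => [p Wp|p [t [_ tW] tp]]; last exact: tW.
  have : nbhs (p : M * M * M) W.
    by apply: cm; exact: open_nbhs_nbhs.
  case=> -[V3 V] /= [[[V1 V2] /= [V1p V2p] V12] Vp] VW.
  have [b1 [Bb1 b1p] b1V] := Bb _ _ V1p.
  have [b2 [Bb2 b2p] b2V] := Bb _ _ V2p.
  have [b3 [Bb3 b3p] b3V] := Bb _ _ Vp.
  exists (b1, b2, b3) => //; split => // -[[x y] z] [[/= hx hy] hz].
  apply: VW; split => /=; last exact: b3V.
  by apply: V12; split; [exact: b1V|exact: b2V].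
rewrite bigcup_set_type; apply: countable_bigcupT_measurable.
  rewrite (eq_countable (card_setT _)).
  apply: (@sub_countable _ _ _ (B `*` B `*` B)).
    by apply: subset_card_le => t [].
  by apply: countableX => //; exact: countableX.
move=> [[[b1 b2] b3] /set_mem [[[/= h1 h2] h3] _]].
by apply: measurableX; [apply: measurableX|];
  apply: sub_sigma_algebra; exact: Bo.
Qed.

Definition self_median (mu : set (borel M) -> \bar R) : set (borel M) -> \bar R :=
  pushforward ((mu \x mu) \x mu)
    ((fun p => m p.1.1 p.1.2 p.2) : borel M * borel M * borel M -> borel M).

(* Measures are functions on all sets, with meaningless values outside of the
   sigma-algebra, hence the comparison on measurable sets only. *)
Definition balanced (mu : set (borel M) -> \bar R) : Prop :=
  forall A : set (borel M), measurable A -> self_median mu A = mu A.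

End self_median.

Definition majority (a b c : bool) : bool :=
  [|| a && b, b && c | a && c].

Definition cube (I : Type) := {ptws I -> bool}.

HB.instance Definition _ (I : Type) := Topological.on (cube I).
HB.instance Definition _ (I : Type) :=
  isPointed.Build (cube I) (fun=> false).

Definition cube_median (I : Type) (x y z : cube I) : cube I :=
  fun i => majority (x i) (y i) (z i).

Lemma majority_median_algebra : median_algebra majority.
Proof. by split; do ![case]. Qed.

Lemma cube_median_algebra (I : Type) : median_algebra (@cube_median I).
Proof.
by have [h1 h2 h3 h4] := majority_median_algebra; split=> *; apply/funext => i;
  rewrite /cube_median.
Qed.

Section uniform.
Context (R : realType).
Local Open Scope ereal_scope.

Definition fair_coin (A : set bool) : \bar R :=
  (2^-1)%:E * \d_false A + (2^-1)%:E * \d_true A.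

(* The product measure is specified by its values on finite-dimensional
   cylinders; these form a pi-system which generates the Borel sigma-algebra
   of the cube when [I] is countable, so at most one probability measure
   satisfies this. *)
Definition is_product_measure (I : choiceType) (P : I -> set bool -> \bar R)
    (L : set (borel (cube I)) -> \bar R) : Prop :=
  forall (J : {fset I}) (A : I -> set bool),
    L [set x : cube I | forall i, i \in J -> A i (x i)]
      = \prod_(i <- J) P i (A i).

Definition is_uniform (I : choiceType) (L : set (borel (cube I)) -> \bar R) : Prop :=
  is_product_measure (fun=> fair_coin) L.

Definition cubical (M : ptopologicalType) (m : M -> M -> M -> M)
    (mu : set (borel M) -> \bar R) : Prop :=
  exists (I : countType) (f : cube I -> M) (L : probability (borel (cube I)) R),
    [/\ injective f, continuous f, median_morphism (@cube_median I) m f,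
        is_uniform L &
        forall A : set (borel M), measurable A ->
          mu A = pushforward L (f : borel (cube I) -> borel M) A].

End uniform.

(* Main.v *)
Require Import Defs.
From mathcomp Require Import all_boot all_order all_algebra finmap.
From mathcomp Require Import all_classical all_reals all_analysis.
From mathcomp Require Import ring lra.
Set Implicit Arguments.
Unset Strict Implicit.
Unset Printing Implicit Defensive.
Import Order.TTheory GRing.Theory Num.Theory.
Import numFieldNormedType.Exports.
Local Open Scope classical_set_scope.
Local Open Scope ring_scope.

(** A half-space of a median algebra (a convex set with convex complement) is
the same thing as a median morphism to the majority algebra on two points, so
a balanced measure pushes forward, along finitely many Borel half-spaces, to a
balanced measure on a finite cube.  Those are easy to understand with Fourier
coefficients.  Writing bits as signs, the majority of three signs is half of
x + y + z - xyz; hence if all the coefficients on proper nonempty subsets of S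
vanish, the coefficient F of S satisfies 2^k F = 3 F + (-1)^k F^3, with k the
cardinal of S ([fourier_minimal]).  For k <= 2 this forces F to be 0, 1 or -1,
and for k >= 3 it forces F = 0 because |F| <= 1.  Read on half-spaces:
almost surely each one is constant or a fair coin, two fair ones are equal,
complementary or independent, and pairwise independent fair ones are mutually
independent ([half_spaces_independent]).

The topology provides enough half-spaces: any point x is in the interior of
some closed half-space that avoids a given other point y
([exists_separating_half_space]), and by second countability a sequence of
closed half-spaces does this for all x and y ([exists_separating_sequence]).
Choose one representative in each class of non-constant members of that
sequence, up to equality and complement almost everywhere; these
representatives are the index set of the cube.  Let [core] be the set of points
at which each of the almost sure relations between members of the sequence
holds.  It has full measure, and it is a subalgebra since each of these
relations is preserved by the median.  By independence, the map recording on
which sides of the representatives a point lies sends mu to the uniform measure,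
and the image of the core meets each cylinder.

It remains to invert this map.  Given a point of the cube, the sets of points of
the core having prescribed sides for finitely many representatives form a filter
base; separation and compactness make it converge, and its limit is the image of
the point of the cube.  Continuity, the morphism property and the inversion
formula on the core pass to the limit.  For injectivity, a continuous morphism
identifying two points that differ at coordinate i does not depend on
coordinate i at all, and then a point on the open side of the i-th half-space
would be a limit of points on the closed side ([exists_cube_map]). *)

(** * Half-spaces of median algebras *)

Section median_algebras.
Context (M : Type) (m : M -> M -> M -> M).
Hypothesis Hm : median_algebra m.

Let mA := medianD Hm.
Let mC := medianCr Hm.
Let mL := medianCl Hm.
Let mxx := medianxx Hm.

Lemma median_xyx x y : m x y x = x. Proof. by rewrite mC mxx. Qed.
Lemma median_yxx x y : m y x x = x. Proof. by rewrite mL median_xyx. Qed.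
Lemma median_rot x y z : m x y z = m z x y. Proof. by rewrite mC mL. Qed.

Lemma median_in_intervall x y z : m x y (m x y z) = m x y z.
Proof. by rewrite !(median_rot x y) mA mxx median_xyx. Qed.

Lemma median_in_intervalr x y z : m x z (m x y z) = m x y z.
Proof. by rewrite (mC x y z) median_in_intervall. Qed.

(** For a fixed base point y, being in the interval from a to y is a partial
order with greatest element y; this is its transitivity. *)
Lemma median_interval_trans y a b c :
  m a y b = b -> m b y c = c -> m a y c = c.
Proof.
move=> ab bc.
have cE : m c b y = c by rewrite -median_rot.
have bE : m b a y = b by rewrite -median_rot.
by rewrite median_rot -{1}cE mA bE median_xyx.
Qed.

Definition half_space (H : set M) :=
  median_convex m H /\ median_convex m (~` H).

Lemma half_space_morphism (H : set M) : half_space H ->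
  median_morphism m majority (fun z => `[< H z >]).
Proof.
move=> [cH cHC] x y z.
have two (P : set M) : median_convex m P ->
    (P x -> P y -> P (m x y z)) /\ (P y -> P z -> P (m x y z)) /\
    (P x -> P z -> P (m x y z)).
  move=> cP; split=> [Px Py|]; last split=> [Py Pz|Px Pz].
  - by apply: (cP x y Px Py); rewrite /median_interval /= median_in_intervall.
  - apply: (cP y z Py Pz); rewrite /median_interval /= -(median_rot y z).
    by rewrite median_in_intervall.
  - by apply: (cP x z Px Pz); rewrite /median_interval /= median_in_intervalr.
have [h1 [h2 h3]] := two _ cH; have [k1 [k2 k3]] := two _ cHC.
rewrite /= in k1 k2 k3; rewrite /majority.
by case: (asboolP (H x)) => hx; case: (asboolP (H y)) => hy;
  case: (asboolP (H z)) => hz /=;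
  ((apply/asboolP; tauto) || (apply/asboolF; tauto)).
Qed.

(** Seen from y, the points hidden behind w (the z with w in [y, z]) form a
convex set, and so do the other points when w is as close to y as a point
outside of V can be: if a and b are visible, then their projections to [y, w]
differ from w, hence are in V, and a point c of [a, b] hidden behind w would
make w a point between these projections, by distributivity. *)
Lemma shadow_half_space (V : set M) y w : median_convex m V -> V y -> ~ V w ->
  (forall u, m w y u = u -> ~ V u -> u = w) ->
  half_space [set z | m y z w = w].
Proof.
move=> cV Vy nVw wmax.
have toV a : m y a w <> w -> V (m y a w).
  move=> ya; apply/not_notP => nVa; apply: ya; apply: wmax nVa.
  by rewrite (mC y) (mL y) median_in_intervall.
have dist a b c : m y (m a b c) w = m c (m y a w) (m y b w).
  by rewrite (mL y) (median_rot a b c) mA -!(mL y).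
split=> [a b /= ya yb c /= abc|a b /= ya yb c /= abc yc].
  by rewrite -abc dist ya yb median_yxx.
apply: nVw; rewrite -yc -abc dist.
apply: cV (toV _ ya) (toV _ yb) _ _.
by rewrite /median_interval /= -(median_rot _ _ c) median_in_intervall.
Qed.

End median_algebras.

Section half_spaces.
Context (M : topologicalType) (m : M -> M -> M -> M).
Hypothesis Tm : topological_median_algebra m.
Hypothesis cM : compact [set: M].
Hypothesis lM : locally_open_convex m.

Let Hm := tma_median Tm.
Let mC := medianCr Hm.
Let mL := medianCl Hm.
Let mxx := medianxx Hm.

Lemma median_continuousr x y : continuous (m x y).
Proof.
move=> z A Az.
have [[B C] /= [Bxy Cz] BC] := @tma_continuous _ _ Tm (x, y, z) _ Az.
apply: filterS Cz => u Cu; apply: (BC (x, y, u)).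
by split => //=; exact: nbhs_singleton.
Qed.

Lemma closed_eq_fun (T : topologicalType) (f g : T -> M) :
  continuous f -> continuous g -> closed [set x | f x = g x].
Proof.
move=> cf cg p cp; apply: (tma_hausdorff Tm) => A B fA gB.
have nAB : nbhs p (f @^-1` A `&` g @^-1` B).
  by apply: filterI; [exact: cf|exact: cg].
have [x [/= xE [Ax Bx]]] := cp _ nAB.
by exists (f x); split=> //; rewrite xE.
Qed.

Lemma closed_interval x y : closed (median_interval m x y).
Proof.
apply: closed_eq_fun; [exact: median_continuousr|by move=> z; exact: cvg_id].
Qed.

(** Zorn's lemma for the order towards y.  A chain is bounded because its
intervals to y are closed and nested, so that they meet K in a common point by
compactness. *)
Lemma exists_closest (K : set M) y : closed K -> K !=set0 ->
  exists2 w, K w & forall u, K u -> m w y u = u -> u = w.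
Proof.
move=> clK [k0 Kk0].
have cK : compact K by exact: subclosed_compact clK cM _.
pose R (a b : {x | K x}) : bool := `[< m (sval a) y (sval b) = sval b >].
have [||||w wmax] := @Zorn {x | K x} R.
- by move=> [a Ka]; apply/asboolP; exact: (median_xyx Hm).
- move=> a b c /asboolP ab /asboolP bc; apply/asboolP.
  exact: (median_interval_trans Hm ab bc).
- move=> [a Ka] [b Kb] /asboolP /= ab /asboolP /= ba.
  have eab : a = b by rewrite -ab -[LHS]ba -(median_rot Hm) mL.
  by move: Ka Kb; rewrite eab => Ka Kb; congr exist; exact: Prop_irrelevance.
- move=> A totA; case: (pselect (A !=set0)) => [[a0 Aa0]|A0]; last first.
    by exists (exist _ k0 Kk0) => s As; case: A0; exists s.
  pose B (a : {x | K x}) : set M := K `&` median_interval m (sval a) y.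
  pose F := filter_from A B.
  have FF : ProperFilter F.
    apply: filter_from_proper; last first.
      move=> a Aa; exists (sval a).
      by split; [exact: (svalP a)|exact: (median_xyx Hm)].
    apply: filter_from_filter; first by exists a0.
    move=> a b Aa Ab; have [/asboolP ab|/asboolP ba] := totA _ _ Aa Ab.
      exists b => // u [Ku bu]; do 2!split => //.
      exact: (median_interval_trans Hm ab bu).
    exists a => // u [Ku bu]; do 2!split => //.
    exact: (median_interval_trans Hm ba bu).
  have FK : F K by exists a0 => // u [].
  have [p [Kp clp]] := cK F FF FK.
  exists (exist _ p Kp) => s As; apply/asboolP => /=.
  apply: closed_interval => N Np.
  have [|u [[_ su] Nu]] := clp (B s) N _ Np; first by exists s.
  by exists u.
exists (sval w); first exact: (svalP w).
by move=> u Ku wu; have /= <- := wmax (exist _ u Ku) (introT (asboolP _) wu).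
Qed.

Lemma closure_convex (C : set M) : median_convex m C ->
  median_convex m (closure C).
Proof.
move=> cC x y Cx Cy z zE A Az.
rewrite -zE in Az.
have [[B D] /= [Bxy Dz] BDA] := @tma_continuous _ _ Tm (x, y, z) _ Az.
have [[E F] /= [Ex Fy] EFB] := Bxy.
have [a [Ca Ea]] := Cx _ Ex; have [b [Cb Fb]] := Cy _ Fy.
exists (m a b z); split; last first.
  apply: (BDA (a, b, z)); split => /=; last exact: nbhs_singleton.
  by apply: (EFB (a, b)).
apply: cC Ca Cb _ _.
by rewrite /median_interval /= (median_in_intervall Hm).
Qed.

(** Let N be a convex neighborhood of x whose closure misses y.  The point a of
that closure closest to y is a gate: it lies between y and each point of N.  Let
V be a convex neighborhood of y missing a, and let w in [a, y] be as close to y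
as possible outside of V.  Then N lies behind a, hence behind w. *)
Lemma exists_separating_half_space x y : x <> y ->
  exists H : set M, [/\ closed H, half_space m H, H° x & ~ H y].
Proof.
move=> xy.
have nbhsN1 (z t : M) : z <> t -> nbhs z (~` [set t]).
  move=> zt; apply: open_nbhs_nbhs; split=> //.
  apply: closed_openC; apply: compact_closed; first exact: tma_hausdorff Tm.
  exact: compact_set1.
(* Regularity leaves room for the closure of a convex neighborhood of x. *)
have [A Ax clA] :=
  compact_regular (tma_hausdorff Tm) cM filterT (nbhsN1 _ _ xy).
have [N [oN cN Nx NA]] := lM Ax.
have nCy : ~ closure N y by move=> /(closure_subset NA) /clA; exact.
have [|a Ca amin] := @exists_closest _ y (@closed_closure _ N).
  by exists x; exact: subset_closure.
have gate z : closure N z -> m a y z = a.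
  move=> Cz; apply: amin; last exact: (median_in_intervall Hm).
  apply: (closure_convex cN Ca Cz).
  by rewrite /median_interval /= (median_in_intervalr Hm).
have ya : y <> a by move=> ya; apply: nCy; rewrite ya.
have [V [oV cV Vy Va]] := lM (nbhsN1 _ _ ya).
have nVa : ~ V a by move=> /Va; exact.
have [||w [nVw aw] wmin] := @exists_closest (~` V `&` median_interval m a y) y.
- by apply: closedI; [exact: open_closedC|exact: closed_interval].
- by exists a; split=> //; exact: (median_xyx Hm).
exists [set z | m y z w = w]; split.
- apply: closed_eq_fun => z; last exact: cvg_cst.
  have -> : (fun z => m y z w) = m y w by apply/funext => ?; rewrite mC.
  exact: median_continuousr.
- apply: (shadow_half_space Hm cV Vy nVw) => u wu nVu; apply: wmin (wu).
  by split=> //; exact: (median_interval_trans Hm aw wu).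
- apply: filterS (open_nbhs_nbhs (conj oN Nx)) => z Nz /=.
  rewrite mL; apply: (median_interval_trans Hm _ aw).
  by rewrite -(median_rot Hm) mL gate//; exact: subset_closure.
- by rewrite /= mxx => yw; apply: nVw; rewrite -yw.
Qed.
End half_spaces.

(** * Balanced measures on finite cubes *)

Section fourier.
Context (R : realFieldType) (T : finType) (p : {ffun T -> bool} -> R).

Definition pointwise_majority (a b c : {ffun T -> bool}) : {ffun T -> bool} :=
  [ffun i => majority (a i) (b i) (c i)].

Hypothesis p_ge0 : forall c, 0 <= p c.
Hypothesis p_sum1 : \sum_c p c = 1.
Hypothesis p_balanced : forall phi : {ffun T -> bool} -> R,
  \sum_c p c * phi c = \sum_a \sum_b \sum_c
    p a * p b * p c * phi (pointwise_majority a b c).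

Definition character (S : {set T}) (c : {ffun T -> bool}) : R :=
  \prod_(i in S) (-1) ^+ c i.

Definition fourier (S : {set T}) : R := \sum_c p c * character S c.

Lemma fourier0 : fourier finset.set0 = 1.
Proof.
rewrite -[RHS]p_sum1; apply: eq_bigr => c _.
by rewrite /character finset.big_set0 mulr1.
Qed.

Lemma fourier_le1 S : `|fourier S| <= 1.
Proof.
rewrite -p_sum1; apply: le_trans (ler_norm_sum _ _ _) _.
apply: ler_sum => c _; rewrite normrM (ger0_norm (p_ge0 c)) /character.
by rewrite normr_prod big1 ?mulr1// => i _; rewrite normrX normrN1 expr1n.
Qed.

(** The majority of three signs is a signed sum of four monomials, indexed by
'I_4: the term j < 3 is the j-th sign, the term 3 is minus the product of all
three.  [uses k j] tells whether the k-th sign occurs in the term j. *)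
Let coef (j : 'I_4) : R := if j == 3 :> nat then -1 else 1.
Let uses (k : nat) (j : 'I_4) : bool := (j == k :> nat) || (j == 3 :> nat).

Lemma sign_majority a b c : 2 * (-1) ^+ majority a b c =
  \sum_(j < 4) coef j * ((-1) ^+ (a && uses 0 j) * (-1) ^+ (b && uses 1 j)
     * (-1) ^+ (c && uses 2 j)) :> R.
Proof.
rewrite !big_ord_recl big_ord0 /coef /uses /=.
by case: a; case: b; case: c => /=; rewrite ?expr1 ?expr0 ?mulrN1 ?mulr1; ring.
Qed.

Lemma character_uses k (S : {set T}) (g : {ffun T -> 'I_4})
    (c : {ffun T -> bool}) :
  \prod_(i in S) (-1) ^+ (c i && uses k (g i)) =
  character [set i in S | uses k (g i)]%SET c.
Proof.
rewrite /character big_set big_mkcondr /=.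
rewrite [RHS](eq_bigl (mem S)); last by move=> ?; rewrite ?inE.
by apply: eq_bigr => i _; case: ifP; case: (c i) => // ->.
Qed.

(** Expand the product over S of the sums of four monomials: a function g
chooses a term at each coordinate, and the three copies of the measure then
contribute independently, each on the coordinates where it is used.  Outside of
S, where there is nothing to choose, g takes the default value 0. *)
Lemma fourier_majority (S : {set T}) : 2 ^+ #|S| * fourier S =
  \sum_(g in pffun_on (ord0 : 'I_4) (mem S) predT) (\prod_(i in S) coef (g i))
    * (fourier [set i in S | uses 0 (g i)]%SET
       * fourier [set i in S | uses 1 (g i)]%SET
       * fourier [set i in S | uses 2 (g i)]%SET).
Proof.
pose phi (c : {ffun T -> bool}) : R := \prod_(i in S) (2 * (-1) ^+ c i).
have -> : 2 ^+ #|S| * fourier S = \sum_c p c * phi c.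
  rewrite /fourier mulr_sumr; apply: eq_bigr => c _.
  by rewrite /phi big_split /= prodr_const mulrCA.
rewrite p_balanced.
pose term a b c (g : {ffun T -> 'I_4}) : R := p a * p b * p c *
  ((\prod_(i in S) coef (g i)) *
   (character [set i in S | uses 0 (g i)]%SET a *
    character [set i in S | uses 1 (g i)]%SET b *
    character [set i in S | uses 2 (g i)]%SET c)).
have step a b c : p a * p b * p c * phi (pointwise_majority a b c) =
    \sum_(g in pffun_on (ord0 : 'I_4) (mem S) predT) term a b c g.
  rewrite -mulr_sumr; congr (_ * _); rewrite /phi.
  under eq_bigr do rewrite ffunE sign_majority.
  rewrite (big_distr_big_dep ord0); apply: eq_bigr => g _.
  by rewrite -!character_uses -!big_split.
under eq_bigr => a _ do under eq_bigr => b _ do under eq_bigr => c _ do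
  rewrite step.
under eq_bigr => a _ do under eq_bigr => b _ do rewrite exchange_big.
under eq_bigr => a _ do rewrite exchange_big.
rewrite exchange_big; apply: eq_bigr => g _ /=.
pose U k := [set i in S | uses k (g i)]%SET.
rewrite -/(U 0) -/(U 1) -/(U 2); set K := \prod_(i in S) _.
transitivity (\sum_a \sum_b \sum_c K * ((p a * character (U 0) a)
    * (p b * character (U 1) b) * (p c * character (U 2) c))).
  by do 3!apply: eq_bigr => ? _; rewrite /term -/K -/(U 0) -/(U 1) -/(U 2);
    ring.
under eq_bigr => a _ do under eq_bigr => b _ do rewrite -!mulr_sumr.
under eq_bigr => a _ do rewrite -mulr_sumr -mulr_suml -mulr_sumr.
by rewrite -mulr_sumr -mulr_suml -mulr_suml.
Qed.

(** In the expansion above, a copy used on a proper nonempty part of S kills the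
summand.  The remaining choices of g are the constant ones: each of the three
single signs contributes one coefficient, and the product of all three signs
contributes the cube, with the sign (-1)^|S|. *)
Lemma fourier_minimal (S : {set T}) : S != finset.set0 ->
  (forall U : {set T}, U \proper S -> U != finset.set0 -> fourier U = 0) ->
  2 ^+ #|S| * fourier S = 3 * fourier S + (-1) ^+ #|S| * fourier S ^+ 3.
Proof.
move=> /set0Pn[i0 Si0] H0; rewrite fourier_majority.
pose cst_on (j : 'I_4) : {ffun T -> 'I_4} :=
  [ffun i => if i \in S then j else ord0].
have F0 (U : {set T}) : U \subset S -> fourier U != 0 ->
    forall i, i \in S -> (i \in U) = (i0 \in U).
  move=> US FU i Si; have [->|U0] := eqVneq U finset.set0;
    first by rewrite !inE.
  have [->|US'] := eqVneq U S; first by rewrite Si Si0.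
  by rewrite H0 ?eqxx ?finset.properEneq ?US' in FU.
have cst_i0 j : cst_on j i0 = j by rewrite ffunE Si0.
rewrite (partition_big (fun g : {ffun T -> 'I_4} => g i0) predT) //=.
pose val j := coef j ^+ #|S| * ((if uses 0 j then fourier S else 1)
  * (if uses 1 j then fourier S else 1) * (if uses 2 j then fourier S else 1)).
transitivity (\sum_(j < 4) val j); last first.
  rewrite !big_ord_recl big_ord0 /val /coef /uses /= !expr1n; ring.
apply: eq_bigr => j _.
rewrite (bigD1 (cst_on j)) /=; last first.
  rewrite cst_i0 eqxx andbT; apply/pffun_onP; split; last by [].
  by apply/supportP => i nSi; rewrite ffunE (negbTE nSi).
rewrite [X in _ + X]big1 ?addr0 => [|g /andP[/andP[gP /eqP gj] gN]].
  rewrite /val; congr (_ * _).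
    under eq_bigr => i Si do rewrite ffunE Si.
    by rewrite prodr_const.
  have E k : fourier [set i in S | uses k (cst_on j i)]%SET =
      if uses k j then fourier S else 1.
    case: ifP => u; last rewrite -fourier0; congr fourier; apply/setP => i;
      by rewrite !inE ffunE; case: ifP; rewrite ?u.
  by rewrite !E.
apply/eqP; apply: contraNT gN; rewrite !mulf_eq0 !negb_or.
move=> /andP[_ /andP[/andP[/F0 F_0 /F0 F_1] /F0 F_2]].
have sub k : [set i in S | uses k (g i)]%SET \subset S.
  by apply/fintype.subsetP => i; rewrite inE => /andP[].
have {}F_0 := F_0 (sub 0%N); have {}F_1 := F_1 (sub 1%N).
have {}F_2 := F_2 (sub 2%N).
apply/eqP/ffunP => i; rewrite ffunE; case: ifP => Si; last first.
  by have /pffun_onP[/supportP-> //] := gP; rewrite Si.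
apply: val_inj; move: (F_0 _ Si) (F_1 _ Si) (F_2 _ Si).
rewrite !inE Si Si0 gj /uses /=.
by case: (g i) => [[|[|[|[|//]]]] ?]; case: j {gj} => [[|[|[|[|//]]]] ?].
Qed.

(** For sets of size 1 and 2, [fourier_minimal] reduces to this equation. *)
Lemma cube_eq_self (x : R) : x ^+ 3 = x ->
  x = 0 \/ exists b : bool, x = (-1) ^+ b.
Proof.
move=> /eqP; rewrite -subr_eq0 (_ : x ^+ 3 - x = x * (x - 1) * (x + 1));
  last by ring.
rewrite !mulf_eq0 subr_eq0 addr_eq0 => /orP[/orP[/eqP ->|/eqP ->]|/eqP ->].
- by left.
- by right; exists false.
- by right; exists true.
Qed.

Lemma fourier_single i : fourier [set i]%SET = 0 \/
  exists b : bool, fourier [set i]%SET = (-1) ^+ b.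
Proof.
apply: cube_eq_self.
have : 2 ^+ #|[set i]%SET| * fourier [set i]%SET = 3 * fourier [set i]%SET
    + (-1) ^+ #|[set i]%SET| * fourier [set i]%SET ^+ 3.
  apply: fourier_minimal => [|U]; first by apply/set0Pn; exists i; rewrite inE.
  by rewrite properE finset.subset1 => /andP[/orP[/eqP->|/eqP->]];
    rewrite ?fintype.subxx ?eqxx.
rewrite cards1 !expr1; lra.
Qed.

Lemma fourier_pair i j : i != j ->
  fourier [set i]%SET = 0 -> fourier [set j]%SET = 0 ->
  fourier [set i; j]%SET = 0 \/
  exists b : bool, fourier [set i; j]%SET = (-1) ^+ b.
Proof.
move=> ij fi fj; apply: cube_eq_self.
have : 2 ^+ #|[set i; j]%SET| * fourier [set i; j]%SET =
    3 * fourier [set i; j]%SET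
    + (-1) ^+ #|[set i; j]%SET| * fourier [set i; j]%SET ^+ 3.
  apply: fourier_minimal => [|U Uij U0].
    by apply/set0Pn; exists i; rewrite !inE eqxx.
  have U1 : #|U| == 1%N.
    have := proper_card Uij; rewrite cards2 ij ltnS leq_eqVlt.
    by rewrite ltnS leqn0 cards_eq0 (negbTE U0) orbF.
  have [x Ux] := cards1P U1; have := proper_sub Uij.
  by rewrite Ux finset.sub1set !inE => /orP[]/eqP ->.
rewrite cards2 ij !expr2; lra.
Qed.

Lemma character_sign S c : exists b : bool, character S c = (-1) ^+ b.
Proof.
apply: (big_ind (fun x : R => exists b : bool, x = (-1) ^+ b)).
- by exists false.
- move=> x y [b ->] [b' ->].
  by exists (b (+) b'); rewrite signr_addb.
- by move=> i _; exists (c i).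
Qed.

(** An average of signs is extremal only if almost all of them are equal. *)
Lemma fourier_sign S (b : bool) : fourier S = (-1) ^+ b ->
  \sum_(c | character S c == (-1) ^+ b) p c = 1.
Proof.
move=> Sb; rewrite -[RHS]p_sum1.
rewrite [RHS](bigID (fun c => character S c == (-1) ^+ b)).
rewrite /= [X in _ + X]big1 ?addr0// => c cb.
have sum0 : \sum_c p c * (1 - (-1) ^+ b * character S c) = 0.
  under eq_bigr do rewrite mulrBr mulr1 mulrCA.
  by rewrite sumrB p_sum1 -mulr_sumr -/(fourier S) Sb -signr_addb addbb subrr.
have term_ge0 e : true -> 0 <= p e * (1 - (-1) ^+ b * character S e).
  have [b' ->] := character_sign S e => _; apply: mulr_ge0 => //.
  by rewrite -signr_addb; case: (_ (+) _); rewrite ?expr1 ?expr0; lra.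
have := psumr_eq0P term_ge0 sum0 (isT : xpredT c).
have [b' cE] := character_sign S c; rewrite cE -signr_addb.
have -> : b (+) b' by move: cb; rewrite cE {cE}; case: b {Sb sum0 term_ge0};
  case: b'; rewrite ?eqxx.
by rewrite expr1; lra.
Qed.

Hypothesis singles : forall i, fourier [set i]%SET = 0.
Hypothesis pairs : forall i j, i != j -> fourier [set i; j]%SET = 0.

(** For |S| >= 3 one has 2^|S| - 3 >= 5, which is incompatible with |F| <= 1
unless F = 0. *)
Lemma fourier_eq0 (S : {set T}) : S != finset.set0 -> fourier S = 0.
Proof.
have [n] := ubnP #|S|; elim: n S => // n IH S /ltnSE Sn S0.
have small := fourier_minimal S0.
have {}small : 2 ^+ #|S| * fourier S =
    3 * fourier S + (-1) ^+ #|S| * fourier S ^+ 3.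
  apply: small => U US U0; apply: IH => //.
  exact: leq_trans (proper_card US) Sn.
have [k2|k3] := leqP #|S| 2.
  move: k2; rewrite leq_eqVlt => /orP[/cards2P[x [y [xy ->]]]|].
    exact: pairs.
  rewrite ltnS leq_eqVlt ltnS leqn0 cards_eq0 (negbTE S0) orbF.
  by move=> /cards1P[x ->].
have le1 := fourier_le1 S.
have ge8 : 8 <= 2 ^+ #|S| :> R.
  by rewrite (_ : 8 = 2 ^+ 3) ?ler_eXn2l ?ltr1n//; rewrite -natrX.
have : `|(2 ^+ #|S| - 3) * fourier S| <= `|fourier S|.
  rewrite mulrBl small addrAC subrr add0r normrM normrX normrN1 expr1n mul1r.
  rewrite normrX -[leRHS]mulr1 exprS ler_wpM2l ?normr_ge0// exprn_ile1//.
apply: contraTeq => FS;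
  rewrite -ltNge normrM -[ltLHS]mul1r ltr_pM2r ?normr_gt0//.
rewrite ger0_norm; lra.
Qed.

(** Each factor is an affine function of the sign of its coordinate; after
expanding, only the product of the constant terms survives. *)
Lemma fourier_product (phi : T -> bool -> R) :
  \sum_c p c * \prod_i phi i (c i) = \prod_i ((phi i false + phi i true) / 2).
Proof.
pose A i := (phi i false + phi i true) / 2.
pose B i := (phi i false - phi i true) / 2.
have phiE (c : {ffun T -> bool}) : \prod_i phi i (c i) = \sum_(S : {set T})
    (\prod_(i in S) B i * \prod_(i in ~: S) A i) * character S c.
  transitivity (\prod_i (B i * (-1) ^+ c i + A i)).
    by apply: eq_bigr => i _; rewrite /A /B; case: (c i);
      rewrite ?expr1 ?expr0; field.
  rewrite bigA_distr; apply: eq_bigr => S _.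
  rewrite (bigID (mem S)) /= mulrAC -big_split /=; congr (_ * _).
    by apply: eq_bigr => i ->.
  by apply: eq_big => [i|i /negbTE->//]; rewrite inE.
under [LHS]eq_bigr => c _ do rewrite phiE mulr_sumr.
rewrite exchange_big (bigD1 finset.set0) //= [X in _ + X]big1 ?addr0 => [|S S0].
  under [LHS]eq_bigr do rewrite mulrCA.
  rewrite -mulr_sumr -/(fourier _) fourier0 mulr1 finset.big_set0 mul1r.
  by apply: eq_bigl => i; rewrite !inE.
under [LHS]eq_bigr do rewrite mulrCA.
by rewrite -mulr_sumr -/(fourier _) fourier_eq0 ?mulr0.
Qed.
End fourier.

(** * Laws of finite families of half-spaces *)

Section finite_codes.
Context d (X : measurableType d) (C : finType) (code : X -> C).
Hypothesis mcode : forall c, measurable (code @^-1` [set c]).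
Local Open Scope ereal_scope.

Let preimage_codeE (P : pred C) : [set x | P (code x)] =
  \big[setU/set0]_(c in P) code @^-1` [set c].
Proof.
rewrite -bigcup_pred; apply/seteqP; split => [x Px|x].
  by exists (code x).
by move=> [c Pc /= ->].
Qed.

Lemma measure_code (R : realType) (nu : {measure set X -> \bar R})
    (P : pred C) :
  nu [set x | P (code x)] = \sum_(c | P c) nu (code @^-1` [set c]).
Proof.
rewrite preimage_codeE big_enum_val measure_bigsetU_ord//.
  by rewrite -(big_enum_val (fun c => nu (code @^-1` [set c]))).
move=> i j _ _ [x [/= xi xj]]; apply: enum_val_inj.
by rewrite -xi -xj.
Qed.

Lemma measurable_code (P : pred C) : measurable [set x | P (code x)].
Proof. by rewrite preimage_codeE; apply: bigsetU_measurable. Qed.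
End finite_codes.

Section law.
Context (R : realType) (M : ptopologicalType) (m : M -> M -> M -> M).
Context (mu : probability (borel M) R) (T : finType) (h : T -> set (borel M)).
Hypothesis bal : balanced m mu.
Hypothesis mh : forall i, measurable (h i).
Hypothesis hh : forall i, half_space m (h i).
Hypothesis Hm : median_algebra m.
Local Open Scope ereal_scope.

Definition code_of (z : borel M) : {ffun T -> bool} := [ffun i => `[< h i z >]].

Lemma measurable_code_of c : measurable (code_of @^-1` [set c]).
Proof.
have -> : code_of @^-1` [set c] =
    \bigcap_(i in [set: T]) (if c i then h i else ~` h i).
  apply/seteqP; split => [z /= <- i _|z zc].
    by rewrite ffunE; case: asboolP.
  apply/ffunP => i; have := zc i I; rewrite ffunE; case: (c i) => hz.
    exact/asboolT.
  exact/asboolF.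
apply: fin_bigcap_measurable; first exact: finite_finset.
by move=> i _; case: ifP => _ //; exact: measurableC.
Qed.

Definition law (c : {ffun T -> bool}) : R := fine (mu (code_of @^-1` [set c])).

Lemma lawE c : mu (code_of @^-1` [set c]) = (law c)%:E.
Proof. by rewrite fineK// fin_num_measure//; exact: measurable_code_of. Qed.

Lemma measure_law (P : pred {ffun T -> bool}) :
  mu [set z | P (code_of z)] = (\sum_(c | P c) law c)%:E.
Proof.
rewrite (measure_code measurable_code_of mu) -sumEFin.
by apply: eq_bigr => c _; exact: lawE.
Qed.

Lemma law_ge0 c : (0 <= law c)%R.
Proof. exact: fine_ge0. Qed.

Lemma law_sum1 : (\sum_c law c = 1)%R.
Proof.
apply: EFin_inj; rewrite -(measure_law predT).
rewrite -[RHS](@probability_setT _ _ _ mu).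
by congr (mu _); apply/seteqP.
Qed.

Lemma code_of_median x y z :
  code_of (m x y z) = pointwise_majority (code_of x) (code_of y) (code_of z).
Proof.
apply/ffunP => i; rewrite !ffunE.
exact: (half_space_morphism Hm (hh i) x y z).
Qed.

Let code3 (q : borel M * borel M * borel M) :=
  (code_of q.1.1, code_of q.1.2, code_of q.2).

(** Half-spaces being morphisms, the median of three points has code c exactly
when their codes have majority c; a triple of codes is a box for the product
measure. *)
Lemma law_balanced1 c : law c =
  (\sum_(t : {ffun T -> bool} * {ffun T -> bool} * {ffun T -> bool} |
      pointwise_majority t.1.1 t.1.2 t.2 == c)
    law t.1.1 * law t.1.2 * law t.2)%R.
Proof.
apply: EFin_inj; rewrite -lawE -(bal (measurable_code_of c)).
rewrite /self_median /pushforward.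
have box t : code3 @^-1` [set t] = (code_of @^-1` [set t.1.1] `*`
    code_of @^-1` [set t.1.2]) `*` code_of @^-1` [set t.2].
  apply/seteqP; split=> [q /= <-|].
    by rewrite /code3 /=.
  by move=> q [[/= q1 q2] q3]; case: t q1 q2 q3 => [[a b] e] /= <- <- <-.
set A := (X in _ X = _).
have -> : A =
    [set q | (fun t => pointwise_majority t.1.1 t.1.2 t.2 == c) (code3 q)].
  apply/seteqP; split => q /=; rewrite /A /= code_of_median; first by move=> ->.
  by move/eqP.
have mb t : measurable (code3 @^-1` [set t]).
  by rewrite box; apply: measurableX; [apply: measurableX|];
    exact: measurable_code_of.
pose P t := pointwise_majority t.1.1 t.1.2 t.2 == c.
apply: etrans (measure_code mb [the measure _ _ of (mu \x mu) \x mu] P) _.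
rewrite -sumEFin; apply: eq_bigr => t _.
rewrite box.
apply: etrans (product_measure1E [the measure _ _ of mu \x mu] mu _ _) _.
- by apply: measurableX; exact: measurable_code_of.
- exact: measurable_code_of.
rewrite !EFinM -!lawE; congr (_ * _).
by apply: product_measure1E; exact: measurable_code_of.
Qed.

Lemma law_balanced (phi : {ffun T -> bool} -> R) :
  (\sum_c law c * phi c = \sum_a \sum_b \sum_c
    law a * law b * law c * phi (pointwise_majority a b c))%R.
Proof.
under eq_bigr => c _ do rewrite law_balanced1 mulr_suml.
rewrite [RHS]pair_big /= [RHS]pair_big /=.
rewrite [RHS](partition_big
  (fun t => pointwise_majority t.1.1 t.1.2 t.2) predT) //=.
by apply: eq_bigr => c _; apply: eq_bigr => t /eqP ->.
Qed.

End law.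

(** * Inverting the map to the cube *)

Section reconstruction.
Context (M : topologicalType) (m : M -> M -> M -> M).
Hypothesis Tm : topological_median_algebra m.
Hypothesis cM : compact [set: M].
Context (I : choiceType) (h : I -> set M) (M0 : set M).
Hypothesis closed_h : forall i, closed (h i).
Hypothesis half_h : forall i, half_space m (h i).
Hypothesis M0_median : forall x y z, M0 x -> M0 y -> M0 z -> M0 (m x y z).

Definition sides (z : M) : cube I := fun i => `[< h i z >].

Definition cylinder (J : {fset I}) (g : cube I) : set M :=
  [set z | M0 z /\ forall i, i \in J -> sides z i = g i].

Hypothesis cylinder_neq0 : forall J g, cylinder J g !=set0.
Hypothesis cylinder_separate : forall x y : M, x <> y ->
  exists (U V : set M) (J : {fset I}), [/\ nbhs x U, nbhs y V &
    forall g, cylinder J g `&` U !=set0 -> cylinder J g `&` V !=set0 -> False].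

Let Hm := tma_median Tm.
Let hM := tma_hausdorff Tm.

Lemma sides_median x y z :
  sides (m x y z) = cube_median (sides x) (sides y) (sides z).
Proof.
apply/funext => i; rewrite /sides /cube_median.
exact: (half_space_morphism Hm (half_h i) x y z).
Qed.

Lemma cylinderU (J J' : {fset I}) g :
  cylinder (J `|` J')%fset g `<=` cylinder J g `&` cylinder J' g.
Proof.
move=> z [M0z zg]; split; split => // i iJ; apply: zg; rewrite in_fsetU iJ//.
by rewrite orbT.
Qed.

(** The candidate image of g is the limit of this filter. *)
Definition cylinders (g : cube I) : set_system M :=
  filter_from [set: {fset I}] (cylinder ^~ g).

Lemma cylinders_proper g : ProperFilter (cylinders g).
Proof.
apply: filter_from_proper => [|J _]; last exact: cylinder_neq0.
apply: filter_fromT_filter; first by exists fset0.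
by move=> J J'; exists (J `|` J')%fset; exact: cylinderU.
Qed.

(** In a compact Hausdorff space a filter with a single cluster point converges,
and two cluster points would be separated by a cylinder. *)
Lemma cylinders_cvg g : exists p : M, cylinders g --> p.
Proof.
have Fg := cylinders_proper g.
have [p [_ clp]] := cM Fg filterT.
exists p; apply: (compact_cluster_set1 hM cM) => //; try exact: filterT.
apply/seteqP; split => [q clq|_ ->//]; apply: contrapT => pq.
have [U [V [J [qU pV sep]]]] := cylinder_separate pq.
have FJ : cylinders g (cylinder J g) by exists J.
by apply: (sep g); [exact: clq|exact: clp].
Qed.

Lemma nbhs_agree (J : {fset I}) (g : cube I) :
  nbhs g [set g' : cube I | forall i, i \in J -> g' i = g i].
Proof.
have -> : [set g' : cube I | forall i, i \in J -> g' i = g i] =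
    \bigcap_(i in [set` J]) [set g' : cube I | g' i = g i] by [].
apply: filter_bigI => i _.
exact: (@proj_continuous I (fun=> bool) i g _ (discrete_set1 _)).
Qed.

(** The map sends g to the limit of the filter of its cylinders. It is a
morphism because M0 is a subalgebra on which taking sides is a morphism, and it
is continuous because the cylinder of g over J belongs to the filters of all the
points of the cube that agree with g on J. *)
Lemma exists_cube_map : exists f : cube I -> M,
  [/\ injective f, continuous f, median_morphism (@cube_median I) m f &
      forall z, M0 z -> f (sides z) = z].
Proof.
have [f fP] := choice cylinders_cvg.
have fs z : M0 z -> f (sides z) = z.
  move=> M0z; apply: hM => A B fA zB.
  have [J _ JA] := fP _ _ fA.
  by exists z; split; [exact: JA|exact: nbhs_singleton].
have fmed : median_morphism (@cube_median I) m f.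
  move=> g1 g2 g3; apply: hM => A B fA mB.
  have [J0 _ J0A] := fP _ _ fA.
  have [[B12 B3] /= [B12f B3f] BB] :=
    @tma_continuous _ _ Tm (f g1, f g2, f g3) _ mB.
  have [[B1 B2] /= [B1f B2f] BB'] := B12f.
  have [J1 _ J1B] := fP _ _ B1f; have [J2 _ J2B] := fP _ _ B2f.
  have [J3 _ J3B] := fP _ _ B3f.
  pose K (J : {fset I}) := (J0 `|` J)%fset.
  have [z1 /cylinderU[[M1 z1g] /J1B Bz1]] := cylinder_neq0 (K J1) g1.
  have [z2 /cylinderU[[M2 z2g] /J2B Bz2]] := cylinder_neq0 (K J2) g2.
  have [z3 /cylinderU[[M3 z3g] /J3B Bz3]] := cylinder_neq0 (K J3) g3.
  exists (m z1 z2 z3); split.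
    apply: J0A; split; first exact: M0_median.
    by move=> i iJ; rewrite sides_median /cube_median z1g ?z2g ?z3g.
  by apply: (BB (z1, z2, z3)); split => //=; apply: (BB' (z1, z2)).
exists f; split => //.
- move=> g g' fgg'; apply/funext => i; apply: contrapT => gi.
  pose set_i (k : cube I) b : cube I := fun j => if j == i then b else k j.
  (* Two points that differ only at i and a third point e have a median in which
     e decides at i and nowhere else.  Taking e = g and e = g', which have the
     same image, shows that f does not depend on coordinate i. *)
  have med k (e : cube I) :
      cube_median (set_i k false) (set_i k true) e = set_i k (e i).
    apply/funext => j; rewrite /cube_median /set_i; case: eqP => [->|_].
      by case: (e i).
    by rewrite /majority; case: (k j); case: (e j).
  have fgi k : f (set_i k (g i)) = f (set_i k (g' i)).
    by rewrite -(med k g) -(med k g') !fmed fgg'.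
  have fflip k : f (set_i k true) = f (set_i k false).
    have := fgi k; move: gi; case: (g i); case: (g' i) => //.
  (* z is in the open set ~` h i, yet it is also the image of the point of the
     cube that agrees with the sides of z except for being inside of h i. *)
  have [z [M0z zi]] := cylinder_neq0 [fset i]%fset (fun=> false).
  have {}zi : sides z i = false by apply: zi; rewrite in_fset1.
  have zE : set_i (sides z) false = sides z.
    by apply/funext => j; rewrite /set_i; case: eqP => // ->.
  have nh : nbhs (f (set_i (sides z) true)) (~` h i).
    rewrite fflip zE fs//; apply: open_nbhs_nbhs; split.
      exact: closed_openC.
    by move: zi; rewrite /sides => /asboolP.
  have [J _ Jh] := fP _ _ nh.
  have [y /cylinderU[yJ [_ yi]]] :=
    cylinder_neq0 (J `|` [fset i])%fset (set_i (sides z) true).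
  apply: (Jh _ yJ); apply/asboolP.
  by have := yi i; rewrite in_fset1 eqxx /set_i eqxx => /(_ isT).
- move=> g U fU.
  have [W fW WU] := compact_regular hM cM filterT fU.
  have [J _ JW] := fP _ _ fW.
  apply: filterS (nbhs_agree J g) => g' gg' /=; apply: WU => B fB.
  have [J' _ J'B] := fP _ _ fB.
  have [z /cylinderU[[M0z zg] /J'B Bz]] := cylinder_neq0 (J `|` J')%fset g'.
  exists z; split => //; apply: JW; split => // i iJ.
  by rewrite zg// gg'.
Qed.

End reconstruction.

(** * Independence of half-spaces *)

Section independence.
Context (R : realType) (M : ptopologicalType) (m : M -> M -> M -> M).
Context (mu : probability (borel M) R) (T : finType) (h : T -> set (borel M)).
Hypothesis bal : balanced m mu.
Hypothesis mh : forall i, measurable (h i).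
Hypothesis hh : forall i, half_space m (h i).
Hypothesis Hm : median_algebra m.
Hypothesis not_constant : forall i b, mu [set z | `[< h i z >] = b] <> 1%E.
Hypothesis not_parallel : forall i j b, i != j ->
  mu [set z | `[< h i z >] (+) `[< h j z >] = b] <> 1%E.

Let p := law mu h.
Let p_ge0 := law_ge0 mu h.
Let p_sum1 := law_sum1 mu mh.
Let p_balanced := law_balanced bal mh hh Hm.

Let fourier_sure (S : {set T}) (b : bool) : fourier p S = (-1) ^+ b ->
  mu [set z | character R S (code_of h z) == (-1) ^+ b] = 1%E.
Proof.
move=> Sb; rewrite (measure_law mu mh (fun c => character R S c == (-1) ^+ b)).
by rewrite (fourier_sign p_ge0 p_sum1 Sb).
Qed.

Let singles i : fourier p [set i]%SET = 0.
Proof.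
have [//|[b /fourier_sure ib]] := fourier_single p_sum1 p_balanced i.
case: (not_constant (i := i) (b := b)); rewrite -{}ib; congr (mu _).
apply/seteqP; split => z /=; rewrite /character finset.big_set1 ffunE.
  by move=> ->.
by move=> /eqP; case: asboolP; case: b => //= _; rewrite ?expr1 ?expr0; lra.
Qed.

Let pairs i j : i != j -> fourier p [set i; j]%SET = 0.
Proof.
move=> ij; have [//|[b /fourier_sure ib]] :=
  fourier_pair p_sum1 p_balanced ij (singles i) (singles j).
case: (not_parallel (b := b) ij); rewrite -{}ib; congr (mu _).
apply/seteqP; split => z /=;
  rewrite /character finset.big_setU1 ?inE//=
    finset.big_set1 !ffunE -signr_addb.
  by move=> ->.
by move=> /eqP; case: (_ (+) _); case: b => //=; rewrite ?expr1 ?expr0; lra.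
Qed.

(** By [fourier_sign], a coefficient equal to 1 or -1 means that a half-space is
almost surely constant, or that two of them are almost surely equal or
complementary.  So the coefficients on sets of size 1 and 2 vanish, and all
nontrivial ones with them. *)
Lemma half_spaces_independent (A : T -> set bool) :
  mu [set z | forall i, A i `[< h i z >]] =
  (\prod_i (((`[< A i false >])%:R + (`[< A i true >])%:R) / 2))%:E.
Proof.
pose phi i b : R := (`[< A i b >])%:R.
rewrite -(fourier_product p_ge0 p_sum1 p_balanced singles pairs phi).
pose P (c : {ffun T -> bool}) := [forall i, `[< A i (c i) >]].
have -> : [set z | forall i, A i `[< h i z >]] = [set z | P (code_of h z)].
  apply/seteqP; split => z /=.
    by move=> Az; apply/forallP => i; rewrite ffunE; apply/asboolP.
  by move=> /forallP Az i; have := Az i; rewrite ffunE => /asboolP.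
rewrite (measure_law mu mh P); congr EFin.
rewrite big_mkcond; apply: eq_bigr => c _; rewrite /P.
case: forallP => [Ac|nA].
  by rewrite big1 ?mulr1// => i _; rewrite /phi Ac.
have [i Ai] : exists i, ~~ `[< A i (c i) >].
  apply: contrapT => nE; apply: nA => i; apply: contrapT => /negP Ai.
  by apply: nE; exists i.
by rewrite (bigD1 i)//= /phi (negbTE Ai) mul0r mulr0.
Qed.
End independence.

(** * Countably many half-spaces and measurability *)

Lemma second_countable_enum (M : topologicalType) : @second_countable M ->
  exists e : nat -> set M, forall x U, nbhs x U ->
    exists n, [/\ nbhs x (e n), e n x & e n `<=` U].
Proof.
case=> B cB [Bo Bb]; move: cB => /pfcard_geP[B0|[e]].
  exists (fun=> set0) => x U xU; have [V [BV _] _] := Bb x _ xU.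
  by move: BV; rewrite B0.
exists e => x U xU; have [V [BV Vx] VU] := Bb x _ xU.
have [n _ nV] := @surj _ _ _ _ e _ BV; exists n; rewrite nV; split => //.
by apply: open_nbhs_nbhs; split=> //; exact: Bo.
Qed.

(** For each pair of basic open sets, choose if possible a closed half-space
containing the first one and disjoint from the second one.  The sequence starts
with the empty half-space, so that a half-space is constant on some set exactly
when it is equal or complementary there to the initial one. *)
Lemma exists_separating_sequence (M : topologicalType) (m : M -> M -> M -> M) :
  sclocc m -> exists H : nat -> set M, [/\ forall n, closed (H n),
    forall n, half_space m (H n), H 0 = set0 &
    forall x y, x <> y -> exists2 n, nbhs x (H n) & ~ H n y].
Proof.
case=> Tm /second_countable_enum[e eP] lM cM.
pose good i j (H : set M) :=
  [/\ closed H, half_space m H, e i `<=` H & e j `<=` ~` H].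
have half0 : half_space m set0 by split=> [x y []|x y _ _ z _ []].
have Kex (ij : nat * nat) : exists H, [/\ closed H, half_space m H &
    (exists H', good ij.1 ij.2 H') -> good ij.1 ij.2 H].
  have [[H gH]|nH] := pselect (exists H', good ij.1 ij.2 H').
    by exists H; have [? ? _ _] := gH.
  by exists set0; split=> //; exact: closed0.
have [K KP] := choice Kex.
exists (fun n => if n is k.+1 then
  (if choice.unpickle k is Some ij then K ij else set0) else set0).
split=> [[|n]|[|n]||x y xy] //=.
- exact: closed0.
- by case: (choice.unpickle n) => [ij|]; [have [] := KP ij|exact: closed0].
- by case: (choice.unpickle n) => [ij|]; [have [] := KP ij|].
have [H [cH hH Hx nHy]] := exists_separating_half_space Tm cM lM xy.
have [i [xi _ iH]] := eP _ _ Hx.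
have yC : nbhs y (~` H).
  by apply: open_nbhs_nbhs; split=> //; exact: closed_openC.
have [j [_ yj jH]] := eP _ _ yC.
have [_ _ [|_ _ iK jK]] := KP (i, j); first by exists H.
exists (choice.pickle (i, j)).+1; rewrite choice.pickleK.
  exact: filterS iK xi.
exact: jK.
Qed.

Lemma probability_bigcap d (X : measurableType d) (R : realType)
    (P : probability X R) (K : countType) (E : K -> set X) :
  (forall k, measurable (E k)) -> (forall k, P (E k) = 1%E) ->
  measurable (\bigcap_k E k) /\ P (\bigcap_k E k) = 1%E.
Proof.
move=> mE PE; pose F n := if choice.unpickle n is Some k then E k else setT.
have mF n : measurable (F n) by rewrite /F; case: (choice.unpickle n).
have -> : \bigcap_k E k = \bigcap_n F n.
  apply/seteqP; split=> [x Ex n _|x Fx k _].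
    by rewrite /F; case: (choice.unpickle n) => // k; exact: Ex.
  by have := Fx (choice.pickle k) I; rewrite /F choice.pickleK.
have mFF : measurable (\bigcap_n F n) by exact: bigcapT_measurable.
split=> //; rewrite -[\bigcap_n F n]setCK.
rewrite probability_setC; last exact: measurableC.
rewrite (@measure_negligible _ _ _ P (~` \bigcap_n F n)) ?sube0//.
  exact: measurableC.
rewrite setC_bigcap; apply: negligible_bigcup => n; apply/negligibleP.
  exact: measurableC.
rewrite [LHS]probability_setC//; rewrite (_ : P (F n) = 1%E) ?subee//.
by rewrite /F; case: (choice.unpickle n) => [k|]; rewrite ?PE//
  probability_setT.
Qed.

Lemma nbhs_cubeP (I : choiceType) (g : cube I) (U : set (cube I)) : nbhs g U ->
  exists J : {fset I}, [set g' : cube I | forall i, i \in J -> g' i = g i]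
    `<=` U.
Proof.
pose B (J : {fset I}) := [set g' : cube I | forall i, i \in J -> g' i = g i].
pose F : set_system (cube I) := filter_from setT B.
have FF : Filter F.
  apply: filter_fromT_filter; first by exists fset0.
  move=> J J'; exists (J `|` J')%fset => g' gg'.
  by split=> i iJ; apply: gg'; rewrite in_fsetU iJ ?orbT.
suff Fg : F --> g by move=> Ug; have [J _ JU] := Fg _ Ug; exists J.
apply/cvg_sup => i A; rewrite nbhsE; case=> O [[V oV <-] Vg] OA.
exists [fset i]%fset => // g' gg'; apply: OA; rewrite /= /proj /=.
by rewrite (gg' i) ?in_fset1.
Qed.

Lemma continuous_measurable (X Y : ptopologicalType) (f : X -> Y) :
  continuous f -> measurable_fun setT (f : borel X -> borel Y).
Proof.
move=> /continuousP cf; apply: measurability; first exact: erefl.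
by move=> _ [U oU <-]; rewrite setTI; apply: sub_sigma_algebra; exact: cf.
Qed.

(** When I is countable there are countably many cylinders, so that every open
set of the cube is a countable union of cylinders. *)
Lemma measurable_sides (M : ptopologicalType) (I : countType) (h : I -> set M) :
  (forall i, closed (h i)) ->
  measurable_fun setT (sides h : borel M -> borel (cube I)).
Proof.
move=> ch; apply: measurability; first exact: erefl.
move=> _ [U oU <-]; rewrite setTI.
pose C (t : seq I * seq I) : set (cube I) :=
  [set g | forall i, i \in t.1 -> g i = (i \in t.2)].
pose D := [set t | C t `<=` U].
have -> : sides h @^-1` U = \bigcup_(t in D) (sides h @^-1` C t).
  apply/seteqP; split=> [z Uz|z [t tU]]; last exact: tU.
  have [J JU] := nbhs_cubeP (open_nbhs_nbhs (conj oU Uz)).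
  have CE i : i \in enum_fset J ->
      (i \in [seq i <- enum_fset J | sides h z i]) = sides h z i.
    by move=> iJ; rewrite mem_filter iJ andbT.
  exists (enum_fset J, [seq i <- enum_fset J | sides h z i]).
    by move=> g gC; apply: JU => i iJ; rewrite gC ?CE.
  by move=> i iJ /=; rewrite CE.
rewrite bigcup_set_type; apply: countable_bigcupT_measurable.
  by rewrite (eq_countable (card_setT _)); exact: countableP.
move=> [t _] /=.
have -> : sides h @^-1` C t =
    \bigcap_(i in [set` t.1]) (if i \in t.2 then h i else ~` h i).
  apply/seteqP; split=> z /= zC i it; have := zC i it.
    by rewrite /sides; case: ifP => _; [move=> /asboolP|move=> /negbT/asboolP].
  by rewrite /sides; case: ifP => _ hz; [exact/asboolT|exact/asboolF].
apply: fin_bigcap_measurable; first exact: finite_seq.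
move=> i _; have mh : measurable (h i : set (borel M)).
  rewrite -(setCK (h i)); apply: measurableC; apply: sub_sigma_algebra.
  exact: closed_openC.
by case: ifP => _ //; exact: measurableC.
Qed.

(** * The core and its independent coordinates *)

Section core.
Context (R : realType) (M : ptopologicalType) (m : M -> M -> M -> M).
Context (mu : probability (borel M) R) (H : nat -> set (borel M)).
Hypothesis bal : balanced m mu.
Hypothesis Hm : median_algebra m.
Hypothesis closed_H : forall n, closed (H n : set M).
Hypothesis half_H : forall n, half_space m (H n).
Hypothesis H0 : H 0%N = set0.

Let mH n : measurable (H n).
Proof.
rewrite -(setCK (H n)); apply: measurableC; apply: sub_sigma_algebra.
exact: closed_openC.
Qed.

Definition agree (t : nat * nat * bool) : set (borel M) :=
  [set z | `[< H t.1.1 z >] (+) `[< H t.1.2 z >] = t.2].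

Definition core : set (borel M) :=
  [set z | forall t, mu (agree t) = 1%E -> agree t z].

(** Equality or complementarity on the core.  Since the core satisfies every
almost sure relation, this is the same as equality or complementarity almost
everywhere, but it is visibly an equivalence relation. *)
Definition parallel (n k : nat) := exists b, core `<=` agree (n, k, b).

Let measurable_agree t : measurable (agree t).
Proof.
pose h (b : bool) := if b then H t.1.1 else H t.1.2.
have mh b : measurable (h b) by rewrite /h; case: b.
pose P (c : {ffun bool -> bool}) := c true (+) c false == t.2.
have -> : agree t = [set z | P (code_of h z)].
  by apply/seteqP; split=> z; rewrite /agree /P /= !ffunE /h /= => /eqP.
exact: measurable_code (measurable_code_of mh) P.
Qed.

Let core_bigcap : measurable core /\ mu core = 1%E.
Proof.
pose E t := if `[< mu (agree t) = 1%E >] then agree t else setT.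
have -> : core = \bigcap_t E t.
  apply/seteqP; split=> [z zc t _|z zE t t1].
    by rewrite /E; case: asboolP => // /zc.
  by have := zE t I; rewrite /E; case: asboolP.
apply: probability_bigcap => t; rewrite /E; case: asboolP => //= _.
by rewrite probability_setT.
Qed.

Lemma measurable_core : measurable core. Proof. exact: core_bigcap.1. Qed.
Lemma measure_core : mu core = 1%E. Proof. exact: core_bigcap.2. Qed.

(** The median of three points of the core inherits each relation because the
majority commutes with negation. *)
Lemma core_median x y z : core x -> core y -> core z -> core (m x y z).
Proof.
move=> cx cy cz t t1; have := cx t t1; have := cy t t1; have := cz t t1.
rewrite /agree /= (half_space_morphism Hm (half_H t.1.1) x y z).
rewrite (half_space_morphism Hm (half_H t.1.2) x y z) /majority.
by case: (t.2); do 6!case: `[< _ >].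
Qed.

Lemma parallel_refl n : parallel n n.
Proof. by exists false => z _; rewrite /agree /= addbb. Qed.

Lemma parallel_sym n k : parallel n k -> parallel k n.
Proof. by move=> [b nk]; exists b => z /nk; rewrite /agree /= addbC. Qed.

Lemma parallel_trans n k l : parallel n k -> parallel k l -> parallel n l.
Proof.
move=> [b nk] [b' kl]; exists (b (+) b') => z zc.
move: (nk z zc) (kl z zc); rewrite /agree /= => <- <-.
by rewrite addbA -(addbA `[< H n z >]) addbb addbF.
Qed.

Lemma not_parallel_agree n k b : ~ parallel n k -> mu (agree (n, k, b)) <> 1%E.
Proof. by move=> nk nk1; apply: nk; exists b => z zc; exact: zc. Qed.

(** The least element of its class, among classes other than that of 0; the
class of 0 consists of the half-spaces that are constant on the core. *)
Definition is_rep (n : nat) : bool :=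
  `[< (0 < n)%N /\ forall k, (k < n)%N -> ~ parallel k n >].

Definition rep_index : countType := {n : nat | is_rep n}.

Definition rep_half_space (i : rep_index) : set (borel M) := H (val i).

Local Notation h := rep_half_space.

Lemma parallel_rep n : parallel 0 n \/ exists i : rep_index, parallel (val i) n.
Proof.
have [N] := ubnP n; elim: N n => // N IH n /ltnSE nN.
case: (pselect (exists2 k, (k < n)%N & parallel k n)) => [[k kn pkn]|nk].
  have [p0k|[i pik]] := IH k (leq_trans kn nN).
    by left; exact: parallel_trans p0k pkn.
  by right; exists i; exact: parallel_trans pik pkn.
case: n nN nk => [|n] nN nk; first by left; exact: parallel_refl.
have nP : is_rep n.+1.
  by apply/asboolP; split=> // k kn pkn; apply: nk; exists k.
by right; exists (exist _ n.+1 nP); exact: parallel_refl.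
Qed.

Lemma rep_not_parallel (i j : rep_index) : i != j -> ~ parallel (val i) (val j).
Proof.
have lt (a b : rep_index) : (val a < val b)%N -> ~ parallel (val a) (val b).
  by move: (svalP b) => /asboolP[_ +]; exact.
move=> ij; have := ij; rewrite -val_eqE neq_ltn => /orP[/lt//|/lt ji pij].
by apply: ji; exact: parallel_sym.
Qed.

Lemma rep_not_constant (i : rep_index) : ~ parallel (val i) 0.
Proof.
by move=> /parallel_sym; have /asboolP[i0] := svalP i; apply.
Qed.

Lemma fair_coinE (A : set bool) : fair_coin R A =
  (((`[< A false >])%:R + (`[< A true >])%:R) / 2)%:E.
Proof.
rewrite /fair_coin !diracE -!EFinM -EFinD; congr EFin.
by rewrite -mulrDr mulrC.
Qed.

Lemma measure_rep_cylinder (J : {fset rep_index}) (A : rep_index -> set bool) :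
  mu [set z | forall i, i \in J -> A i (sides h z i)] =
  (\prod_(i <- J) fair_coin R (A i))%E.
Proof.
pose hJ (t : J) : set (borel M) := h (val t).
have mhJ t : measurable (hJ t) by exact: mH.
have hhJ t : half_space m (hJ t) by exact: half_H.
have nc t b : mu [set z | `[< hJ t z >] = b] <> 1%E.
  have := @not_parallel_agree _ _ b (@rep_not_constant (val t)).
  congr (mu _ <> _); apply/seteqP; split=> z; rewrite /agree /= H0;
    by rewrite (asboolF (_ : ~ set0 z))// addbF.
have np (s t : J) b : s != t ->
    mu [set z | `[< hJ s z >] (+) `[< hJ t z >] = b] <> 1%E.
  move=> st; apply: (@not_parallel_agree _ _ b); apply: rep_not_parallel.
  by rewrite val_eqE.
have indep := half_spaces_independent bal mhJ hhJ Hm nc np (fun t => A (val t)).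
rewrite big_seq_fsetE /=; under eq_bigr do rewrite fair_coinE.
rewrite prodEFin -indep; congr (mu _); apply/seteqP; split=> z /= zA.
  by move=> t; apply: zA; exact: (valP t).
by move=> i iJ; exact: (zA [` iJ]%fset).
Qed.

(** A cylinder has positive measure, so it meets the core. *)
Lemma cylinder_core_neq0 (J : {fset rep_index}) (g : cube rep_index) :
  cylinder h core J g !=set0.
Proof.
apply: contrapT => /set0P/negP/negPn/eqP cyl0.
pose A i : set bool := [set g i].
have cylE : [set z | forall i, i \in J -> A i (sides h z i)] =
    \bigcap_(i in [set` J]) (if g i then h i else ~` h i).
  apply/seteqP; split=> z zg i iJ; have := zg i iJ; rewrite /A /sides /=.
    by case: (g i); [move=> /asboolP|move=> /negbT/asboolP].
  by case: (g i) => hz; [exact/asboolT|exact/asboolF].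
have : (0 < mu [set z | forall i, i \in J -> A i (sides h z i)])%E.
  rewrite measure_rep_cylinder; under eq_bigr do rewrite fair_coinE.
  rewrite prodEFin lte_fin; apply: prodr_gt0 => i _; rewrite /A /=.
  by case: (g i); rewrite (asboolT (erefl _)) asboolF// ?addr0 ?add0r divr_gt0.
apply/negP; rewrite -leNgt.
have <- : mu (~` core) = 0%E.
  by rewrite probability_setC ?measure_core ?subee//; exact: measurable_core.
apply: le_measure; rewrite ?inE.
- rewrite cylE; apply: fin_bigcap_measurable; first exact: finite_fset.
  by move=> i _; case: ifP => _; [exact: mH|apply: measurableC; exact: mH].
- by apply: measurableC; exact: measurable_core.
- move=> z zg zc; have : cylinder h core J g z by split=> // i /zg.
  by rewrite cyl0.
Qed.

Hypothesis separating_H : forall x y : M, x <> y ->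
  exists2 n, nbhs x (H n : set M) & ~ H n y.

(** The separating half-space is parallel either to a constant one, and then one
of its sides misses the core, or to a representative, whose side
is prescribed by the cylinder. *)
Lemma cylinder_core_separate (x y : M) : x <> y ->
  exists (U V : set M) (J : {fset rep_index}), [/\ nbhs x U, nbhs y V &
    forall g, cylinder h core J g `&` U !=set0 ->
      cylinder h core J g `&` V !=set0 -> False].
Proof.
move=> /separating_H[n xn nny].
have yn : nbhs y (~` H n : set M).
  by apply: open_nbhs_nbhs; split=> //; exact: closed_openC.
have [[b pb]|[i [b pb]]] := parallel_rep n.
  exists (H n), (~` H n), fset0; split=> // g.
  move=> [z [[zc _] nz]] [z' [[zc' _] nz']].
  have set0F u : `[< (set0 : set (borel M)) u >] = false by exact: asboolF.
  have := pb z zc; have := pb z' zc'; rewrite /agree /= H0 !set0F.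
  by rewrite (asboolT nz) (asboolF nz') => <-.
exists (H n), (~` H n), [fset i]%fset; split=> // g.
move=> [z [[zc /(_ i)]]]; rewrite in_fset1 eqxx => /(_ isT) zi nz.
move=> [z' [[zc' /(_ i)]]]; rewrite in_fset1 eqxx => /(_ isT) zi' nz'.
have := pb z zc; have := pb z' zc'; rewrite /agree /=.
rewrite (asboolT nz) (asboolF nz').
rewrite -/(h i) -/(sides h z i) -/(sides h z' i) zi zi' => <-.
by case: (g i).
Qed.

End core.

Theorem theorem1p1 (R : realType) (M : ptopologicalType)
    (m : M -> M -> M -> M) (mu : probability (borel M) R) :
  sclocc m -> balanced m mu -> cubical m mu.
Proof.
move=> sm bal; have [Tm _ _ cM] := sm; have Hm := tma_median Tm.
have [H [cH hH H0 sepH]] := exists_separating_sequence sm.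
pose h := @rep_half_space R M mu H.
have ch i : closed (h i : set M) by exact: cH.
have hh i : half_space m (h i) by exact: hH.
have mcore := measurable_core mu cH.
have [f [injf cf medf fK]] := exists_cube_map Tm cM ch hh
  (core_median Hm hH) (cylinder_core_neq0 bal Hm cH hH H0)
  (@cylinder_core_separate _ _ mu _ cH H0 sepH).
have ms := measurable_sides ch.
pose s : {mfun borel M >-> borel (cube (rep_index mu H))} :=
  mfun_Sub (mem_set ms).
exists (rep_index mu H), f, (distribution mu s); split=> //.
  by move=> J A; exact: (measure_rep_cylinder bal Hm cH hH H0 J A).
move=> A mA; rewrite /pushforward /distribution /pushforward /=.
have mfA : measurable (f @^-1` A : set (borel (cube (rep_index mu H)))).
  by rewrite -[_ @^-1` _]setTI; exact: (continuous_measurable cf).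
have msfA : measurable (sides h @^-1` (f @^-1` A) : set (borel M)).
  by rewrite -[_ @^-1` _]setTI; exact: (ms measurableT).
have mC : mu (~` core mu H) = 0%E.
  by rewrite probability_setC ?measure_core ?subee//; exact: measurable_core.
have mCc : measurable (~` core mu H) by exact: measurableC.
(* A and its preimage by f \o sides h agree on the core, of full measure. *)
apply: etrans (esym (measureU0 mA mCc mC)) _.
apply: etrans (measureU0 msfA mCc mC); congr (mu _).
apply/seteqP; split=> z [Az|]; rewrite /setU /=; try by right.
  by have [zc|] := pselect (core mu H z); [left; rewrite fK|right].
by have [zc|] := pselect (core mu H z); [left; rewrite -(fK z zc)|right].
Qed.
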